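(* For all integers $d\geq 1$ and $k\geq -1$ there exists a positive integer $N$ such that the following holds: if $X\subset\mathbb{R}^d$ is a finite multiset with $\varphi(X)\geq N$, then the general position complex $G(X)$ is $k$-connected. (The minimal such $N$ is denoted $g_d(k)$.)
   Context: A (multi)set of points in $\mathbb{R}^d$ is in general position if every sub(multi)set of size at most $d+1$ is affinely independent (in particular a repeated point is never in general position with its copy). For a finite multiset $X\subset\mathbb{R}^d$, $\varphi(X)$ denotes the maximal size of a subset of $X$ in general position. The general position complex $G(X)$ is the simplicial complex whose vertices are the elements of $X$ counted with multiplicity and whose simplices are the subsets $S\subset X$ in general position. A topological space is $k$-connected if every continuous map $\mathbb{S}^i\to X$ extends to $\mathbb{B}^{i+1}\to X$ for $i=-1,0,\dots,k$; in particular $(-1)$-connected means non-empty. *)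

(* Defs.v *)
From HB Require Import structures.
From mathcomp Require Import all_boot all_order all_algebra.
From mathcomp Require Import all_classical all_reals all_analysis.

Set Implicit Arguments.
Unset Strict Implicit.
Unset Printing Implicit Defensive.

Import Order.TTheory GRing.Theory Num.Theory.
Import numFieldNormedType.Exports.

Local Open Scope classical_set_scope.
Local Open Scope ring_scope.

(* The Euclidean norm is spelled out: the library norm on row vectors is the
   sup norm. For m = 0 the sphere is empty and the ball is a point. *)
Definition euclidean_sphere (R : realType) (m : nat) : set 'rV[R]_m :=
  [set x | \sum_(j < m) x 0 j ^+ 2 = 1].

Definition euclidean_ball (R : realType) (m : nat) : set 'rV[R]_m :=
  [set x | \sum_(j < m) x 0 j ^+ 2 <= 1].

Arguments euclidean_sphere : clear implicits.
Arguments euclidean_ball : clear implicits.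

(* With m = i + 1, the sphere S^i and the ball B^(i+1) both live in R^m, and
   -1 <= i <= k becomes 0 <= m <= k + 1. Sets are coerced to types
   carrying the subspace topology. *)
Definition k_connected (R : realType) (k : int) (T : topologicalType) : Prop :=
  forall m : nat, m%:Z <= k + 1 ->
  forall f : euclidean_sphere R m -> T, continuous f ->
  exists2 g : euclidean_ball R m -> T, continuous g &
    forall (x : euclidean_sphere R m) (y : euclidean_ball R m),
      val x = val y -> g y = f x.

(* The standard geometric realization, in barycentric coordinates, of a
   complex K on the vertex set 'I_n. *)
Definition realization (R : realType) (n : nat) (K : {set {set 'I_n}}) :
    set 'rV[R]_n :=
  [set p | [/\ forall i, 0 <= p 0 i,
               \sum_(i < n) p 0 i = 1 &
               [set i | p 0 i != 0]%SET \in K]].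

Arguments realization R {n} K.

Section GeneralPosition.
Variables (R : realType) (d n : nat).

(* A finite multiset of points of R^d is a finite family X; its elements
   counted with multiplicity are the indices. *)
Variable X : 'I_n -> 'rV[R]_d.

Definition affinely_independent (S : {set 'I_n}) : Prop :=
  forall c : 'I_n -> R,
    \sum_(i in S) c i = 0 -> \sum_(i in S) c i *: X i = 0 ->
    forall i, i \in S -> c i = 0.

Definition general_position (S : {set 'I_n}) : Prop :=
  forall S' : {set 'I_n}, S' \subset S -> (#|S'| <= d.+1)%N ->
    affinely_independent S'.

Definition phi : nat :=
  \max_(S : {set 'I_n} | `[< general_position S >]) #|S|.

Definition general_position_complex : {set {set 'I_n}} :=
  [set S : {set 'I_n} | `[< general_position S >]]%SET.

End GeneralPosition.

(* Main.v *)
(** Let [T] be a large set in general position. A set [U] of boundedly many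
vertices spans boundedly many proper flats, and each contains at most [d] points
of [T]; so some [t] in [T] avoids them all, and adding [t] keeps every simplex
inside [U] in general position.

A map [f] from a sphere to the realization is first moved, inside the simplices
carrying it, to a combination of vertices [v a] weighted by bump functions
centred at the points [a] of a fine grid, at most [2 ^ m] of which are active at
any point. Then apexes [t s] in [T] are chosen for all sets [s] of at most
[2 ^ m] grid points, by induction on [s], each one coning off the vertices of [s]
and the apexes of its proper subsets. For a level [c], what the bumps have above
[c] stays on the vertices [v a], while what they have below [c] is put on the
apexes of the superlevel sets. The superlevel sets form a flag of sets
containing all [a] whose bump exceeds [c], so the support is always a simplex.
Raising [c] moves the map into the simplex [T], where it is defined on the whole
ball. *)

Require Import Defs.
From mathcomp Require Import all_boot all_order all_algebra.
From mathcomp Require Import all_classical all_reals all_analysis.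
From mathcomp Require Import ring lra zify.

Import Order.TTheory GRing.Theory Num.Theory.
Import numFieldNormedType.Exports.

Local Open Scope classical_set_scope.
Local Open Scope ring_scope.

Set Implicit Arguments.
Unset Strict Implicit.
Unset Printing Implicit Defensive.

(** * Affine spans, and points of a set in general position that avoid them *)

Section AffineSpan.
Variables (R : realType) (d n : nat) (X : 'I_n -> 'rV[R]_d).
Implicit Types (B S T U : {set 'I_n}) (t : 'I_n).

Definition in_affine_span S (x : 'rV[R]_d) : Prop :=
  exists2 c : 'I_n -> R, \sum_(i in S) c i = 1 & \sum_(i in S) c i *: X i = x.

Lemma in_affine_span_mem S t : t \in S -> in_affine_span S (X t).
Proof.
move=> tS; exists (fun i => (i == t)%:R).
  rewrite (bigD1 t)//= eqxx big1 ?addr0// => i /andP[_ /negPf ->] //.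
rewrite (bigD1 t)//= eqxx scale1r big1 ?addr0// => i /andP[_ /negPf ->].
by rewrite scale0r.
Qed.

Lemma affinely_independent_setU1 S t : affinely_independent X S ->
  ~ in_affine_span S (X t) -> affinely_independent X (t |: S).
Proof.
move=> indS tS c; have tNS : t \notin S.
  by apply/negP => /in_affine_span_mem.
rewrite !big_setU1//= => c0 cX.
have ct : c t = 0.
  apply/eqP; apply/negPn/negP => ct; apply: tS.
  exists (fun i => - c i / c t).
    by rewrite -mulr_suml sumrN -(addr0_eq c0) opprK divff.
  have -> : X t = (- (c t)^-1) *: \sum_(i in S) c i *: X i.
    rewrite -(addr0_eq cX) scalerN scaleNr opprK scalerA mulVf// scale1r//.
  rewrite scaler_sumr; apply: eq_bigr => i _.
  by rewrite scalerA; congr (_ *: _); ring.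
move: c0 cX; rewrite ct scale0r !add0r => c0 cX i.
by rewrite in_setU1 => /orP[/eqP->//|]; exact: indS.
Qed.

(** The coefficients of the points of [B] over those of [S] form a matrix whose rows sum to 1. With
    more rows than columns it has a nonzero left kernel vector, which is an affine dependence of
    [B]. *)
Lemma affinely_independent_card_le B S : affinely_independent X B ->
  (forall b, b \in B -> in_affine_span S (X b)) -> (#|B| <= #|S|)%N.
Proof.
move=> indB BS; rewrite leqNgt; apply/negP => ltSB.
have /choice[c cP] : forall b, exists c : 'I_n -> R, b \in B ->
    \sum_(i in S) c i = 1 /\ \sum_(i in S) c i *: X i = X b.
  move=> b; have [/BS[c c1 cX]|bB] := boolP (b \in B); first by exists c.
  by exists (fun=> 0).
pose C : 'M[R]_(#|B|, #|S|) := \matrix_(i, j) c (enum_val i) (enum_val j).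
have /rowV0Pn[w /sub_kermxP wC w0] : kermx C != 0.
  by rewrite kermx_eq0 /row_free; apply: contraL ltSB => /eqP <-;
    rewrite -leqNgt rank_leq_col.
have [b0 b0B] : exists b0, b0 \in B.
  by apply/card_gt0P; apply: leq_ltn_trans ltSB.
pose e b := w 0 (enum_rank_in b0B b).
have eK i : e (enum_val i) = w 0 i by rewrite /e enum_valK_in.
have wc s : s \in S -> \sum_(b in B) e b * c b s = 0.
  move=> sS; rewrite big_enum_val/=; under eq_bigr do rewrite eK.
  move/matrixP/(_ 0 (enum_rank_in sS s)): wC; rewrite !mxE => wC; rewrite -[RHS]wC.
  by apply: eq_bigr => i _; rewrite mxE enum_rankK_in.
have e0 : \sum_(b in B) e b = 0.
  transitivity (\sum_(b in B) \sum_(s in S) e b * c b s).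
    by apply: eq_bigr => b bB; rewrite -mulr_sumr (cP b bB).1 mulr1.
  by rewrite exchange_big big1.
have eX : \sum_(b in B) e b *: X b = 0.
  transitivity (\sum_(b in B) \sum_(s in S) (e b * c b s) *: X s).
    apply: eq_bigr => b bB; rewrite -[X b in LHS](cP b bB).2 scaler_sumr.
    by apply: eq_bigr => s _; rewrite scalerA.
  rewrite exchange_big big1 => // s sS.
  by rewrite -scaler_suml wc// scale0r.
move/eqP: w0; apply; apply/rowP => i; rewrite mxE -eK.
by apply: indB => //; exact: enum_valP.
Qed.

(** Any [d.+1] points of [T] are affinely independent, too many for the span of at most [d]
    points. *)
Lemma general_position_span_card T S : general_position X T -> (#|S| <= d)%N ->
  (#|[set t in T | `[< in_affine_span S (X t) >]]%SET| <= d)%N.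
Proof.
move=> gT Sd; set B := [set t in T | _]%SET; rewrite leqNgt; apply/negP => dB.
pose B' := [set b in take d.+1 (enum B)]%SET.
have B'B b : b \in B' -> b \in B.
  by rewrite inE => /mem_take; rewrite mem_enum.
have cB' : #|B'| = d.+1.
  rewrite cardsE (card_uniqP _) ?size_takel -?cardE//.
  by rewrite take_uniq// enum_uniq.
suff : (#|B'| <= #|S|)%N by rewrite cB' leqNgt ltnS Sd.
apply: affinely_independent_card_le.
  apply: gT; last by rewrite cB'.
  by apply/fintype.subsetP => b /B'B; rewrite inE => /andP[].
by move=> b /B'B; rewrite inE => /andP[_ /asboolP].
Qed.

Lemma general_position_sub S S' : S' \subset S ->
  general_position X S -> general_position X S'.
Proof. by move=> S'S gS S'' ? ?; apply: gS => //; apply: fintype.subset_trans S'S. Qed.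

(** Each subset of [U] rules out at most [d] points of [T]. Only subsets of size at most [d] have to
    be avoided: the sets to be tested have at most [d.+1] elements, and the new ones contain [t]. *)
Lemma general_position_cone T U : general_position X T ->
  (2 ^ #|U| * d < #|T|)%N ->
  exists2 t, t \in T & forall S, S \subset U -> general_position X S ->
    general_position X (t |: S).
Proof.
move=> gT TU; pose bad S := [set t in T | `[< in_affine_span S (X t) >]]%SET.
pose Bad := \bigcup_(S in powerset U | (#|S| <= d)%N) bad S.
have [t tT tB] : exists2 t, t \in T & t \notin Bad.
  suff /subsetPn[t] : ~~ (T \subset Bad) by exists t.
  apply: contraL TU => /subset_leq_card TB; rewrite -leqNgt.
  apply: leq_trans TB _; rewrite -card_powerset.
  apply: (@leq_trans (\sum_(S in powerset U | (#|S| <= d)%N) #|bad S|)).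
    rewrite /Bad; elim/big_ind2: _ => [|A a C b Aa Cb|//]; first by rewrite cards0.
    by apply: leq_trans (leq_card_setU _ _) _; exact: leq_add.
  rewrite -sum_nat_const big_mkcondr/=; apply: leq_sum => S _.
  by case: ifP => // Sd; exact: general_position_span_card.
exists t => // S SU gS S' S'tS S'd.
have [tS'|tS'] := boolP (t \in S'); last first.
  apply: gS => //; apply/fintype.subsetP => i iS'; have := fintype.subsetP S'tS i iS'.
  by rewrite in_setU1 => /orP[/eqP it|//]; rewrite it (negPf tS') in iS'.
have S'S : S' :\ t \subset S by rewrite subDset.
have S'td : (#|S' :\ t| <= d)%N by move: S'd; rewrite (cardsD1 t) tS'.
rewrite -(finset.setD1K tS'); apply: affinely_independent_setU1.
  by apply: gS => //; exact: leqW.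
move=> spn; move/negP: tB; apply; apply/finset.bigcupP; exists (S' :\ t).
  by rewrite powersetE (fintype.subset_trans S'S).
by rewrite inE tT; apply/asboolP.
Qed.

Lemma phi_witness : exists2 T, general_position X T & phi X = #|T|.
Proof.
have g0 : general_position X finset.set0.
  move=> S; rewrite finset.subset0 => /eqP -> _ c _ _ i; by rewrite inE.
rewrite /phi; have [|T /asboolP gT ->] := @eq_bigmax_cond _
    (fun S => `[< general_position X S >]) (fun S : {set 'I_n} => #|S|).
  by apply/card_gt0P; exists finset.set0; apply/asboolP.
by exists T.
Qed.
End AffineSpan.

(** * Simultaneous choice of cone apexes in an abstract complex *)

Section ConeApexes.
Variables (A : finType) (n : nat) (K : {set {set 'I_n}}) (T : {set 'I_n}).
Variables (v : A -> 'I_n) (D : nat).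

Definition apexes_below (t : {set A} -> 'I_n) (s : {set A}) : {set 'I_n} :=
  (v @: s :|: t @: [set s' : {set A} | s' \proper s])%SET.

(** All that the filling uses of general position, besides closure of [K] under subsets and [T]
    being a simplex. Membership in [T] serves the last stage, where only apexes carry weight. *)
Definition cone_apex (U : {set 'I_n}) (t : 'I_n) : Prop :=
  t \in T /\ forall S : {set 'I_n}, S \subset U -> S \in K -> t |: S \in K.

(** Induction on a bound for [#|s|]: [apexes_below t s] involves [t] only at proper subsets of [s],
    so choosing apexes for one more cardinality spoils none of the earlier ones. The bound counts at
    most [D] values of [v] and [2 ^ D] apexes. *)
Lemma cone_apexes_exist :
  (forall U : {set 'I_n}, (#|U| <= D + 2 ^ D)%N -> exists t, cone_apex U t) ->
  exists t : {set A} -> 'I_n,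
    forall s : {set A}, (#|s| <= D)%N -> cone_apex (apexes_below t s) (t s).
Proof.
move=> coneU.
have [t0 _] : exists t, cone_apex finset.set0 t.
  by apply: coneU; rewrite cards0.
have /choice[ch chP] : forall U : {set 'I_n}, exists t,
    (#|U| <= D + 2 ^ D)%N -> cone_apex U t.
  move=> U; have [/coneU[t tP]|_] := leqP #|U| (D + 2 ^ D); first by exists t.
  by exists t0.
suff H k : (k <= D.+1)%N -> exists t : {set A} -> 'I_n,
    forall s : {set A}, (#|s| < k)%N -> cone_apex (apexes_below t s) (t s).
  by have [t tP] := H D.+1 (leqnn _); exists t => s; exact: tP.
elim: k => [_|k IHk kD]; first by exists (fun=> t0).
have [t tP] := IHk (ltnW kD).
pose t' (s : {set A}) := if (#|s| < k)%N then t s else ch (apexes_below t s).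
have tt' (s : {set A}) : (#|s| <= k)%N -> apexes_below t' s = apexes_below t s.
  move=> sk; congr (_ :|: _)%SET; apply: eq_in_imset => s'.
  by rewrite inE => /proper_card s's; rewrite /t' (leq_trans s's).
exists t' => s; rewrite ltnS => sk; rewrite tt'// /t'.
case: ifP => [|_]; first exact: tP.
apply: chP; rewrite /apexes_below.
apply: leq_trans (leq_card_setU _ _) _.
have sD : (#|s| <= D)%N by rewrite (leq_trans sk).
apply: leq_add; first exact: leq_trans (leq_imset_card _ _) _.
apply: leq_trans (leq_imset_card _ _) _.
apply: (@leq_trans #|powerset s|).
  by apply: subset_leq_card; apply/fintype.subsetP => s';
    rewrite inE powersetE => /proper_sub.
by rewrite card_powerset leq_exp2l.
Qed.

(* The flag [C] is coned off one apex at a time, from its smallest set to its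
   largest. *)
Lemma cone_apexes_chain (t : {set A} -> 'I_n) (B : {set A}) (C : {set {set A}}) :
  (forall s : {set A}, (#|s| <= D)%N -> cone_apex (apexes_below t s) (t s)) ->
  (forall s, s \in C -> (#|s| <= D)%N && (B \subset s)) ->
  (forall s s', s \in C -> s' \in C -> (s \subset s') || (s' \subset s)) ->
  v @: B \in K -> (v @: B :|: t @: C)%SET \in K.
Proof.
move=> tP; move: {2}#|C| (erefl #|C|) => k.
elim: k C => [|k IHk] C kC CD Ctot vB.
  by move/eqP: kC; rewrite cards_eq0 => /eqP ->; rewrite imset0 finset.setU0.
have [s0 s0C] : exists s, s \in C by apply/card_gt0P; rewrite kC.
have [s sC smax] := @arg_maxnP _ s0 (mem C) (fun s : {set A} => #|s|) s0C.
have {}sC : s \in C := sC.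
have Cs s' : s' \in C :\ s -> s' \proper s.
  rewrite in_setD1 => /andP[s's s'C]; rewrite finset.properEneq s's /=.
  have /orP[ss'|//] := Ctot s s' sC s'C.
  by move: s's; rewrite eq_sym finset.eqEcard ss'; have /= -> := smax s' s'C.
have -> : (v @: B :|: t @: C = t s |: (v @: B :|: t @: (C :\ s)))%SET.
  rewrite -{1}(finset.setD1K sC) imsetU imset_set1.
  by rewrite finset.setUCA.
have /andP[sD Bs] := CD s sC.
(* [B] lies in [s] and the other members of [C] are proper subsets of [s], so everything except
   [t s] lies in [apexes_below t s]. *)
apply: (tP s sD).2.
  apply: finset.setUSS; first exact: imsetS.
  by apply: imsetS; apply/fintype.subsetP => s' /Cs; rewrite inE.
apply: IHk => //.
- by apply/eqP; rewrite -eqSS -kC (cardsD1 s C) sC.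
- by move=> s'; rewrite in_setD1 => /andP[_ /CD].
- by move=> s1 s2; rewrite !in_setD1 => /andP[_ +] /andP[_]; exact: Ctot.
Qed.
End ConeApexes.

(** * Weights on the superlevel sets of a function *)

Section FlagWeight.
Variables (R : realType) (A : finType).
Implicit Types (f : A -> R) (c : R) (s : {set A}).

(* For [f >= 0] and [c > 0] this is nonzero exactly when [s] is the set where
   [min (f a) c] exceeds some level [l >= 0]. *)
Definition flag_weight f c s : R :=
  \prod_(a in s) (f a * \prod_(b | b \notin s) Num.max 0 (Num.min (f a) c - f b)).

Lemma flag_weight_ge0 f c s : (forall a, 0 <= f a) -> 0 <= flag_weight f c s.
Proof.
move=> f0; apply: prodr_ge0 => a _; apply: mulr_ge0 => //.
by apply: prodr_ge0 => b _; rewrite le_max lexx.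
Qed.

(** The bound [f b < f a] makes the nonempty sets of nonzero weight nested; [f b < c] makes each of
    them contain every point where [f] is at least [c]. *)
Lemma flag_weight_neq0 f c s a : flag_weight f c s != 0 -> a \in s ->
  f a != 0 /\ forall b, b \notin s -> f b < f a /\ f b < c.
Proof.
move=> /prodf_neq0 ws /ws; rewrite mulf_eq0 negb_or => /andP[fa0].
move=> /prodf_neq0 ab; split=> // b /ab.
have [_|] := leP (Num.min (f a) c - f b) 0; first by rewrite eqxx.
by rewrite subr_gt0 lt_min => /andP[].
Qed.

(** The support is the superlevel set at level 0. Its weight ensures that the weights never vanish
    all at once. *)
Lemma flag_weight_support_gt0 f c : (forall a, 0 <= f a) -> 0 < c ->
  0 < flag_weight f c [set a | f a != 0]%SET.
Proof.
move=> f0 c0; apply: prodr_gt0 => a; rewrite inE => fa0.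
have fa : 0 < f a by rewrite lt_def fa0 f0.
apply: mulr_gt0 => //; apply: prodr_gt0 => b; rewrite inE negbK => /eqP ->.
by rewrite subr0 lt_max lt_min fa c0 orbT.
Qed.
End FlagWeight.

(** * Bump functions on a cubical grid *)

Section GridBumps.
Variables (R : realType) (m M : nat).

(** A product of tents. For positive [M] its centre has coordinates [a j / M - 1]; these centres
    form a grid of mesh [1 / M] on the cube with coordinates between -1 and 1. *)
Definition grid_bump (a : {ffun 'I_m -> 'I_(2 * M).+1}) (x : 'rV[R]_m) : R :=
  \prod_(j < m) Num.max 0 (1 - `|M%:R * (x 0 j + 1) - (a j)%:R|).

Lemma grid_bump_ge0 a x : 0 <= grid_bump a x.
Proof. by apply: prodr_ge0 => j _; rewrite le_max lexx. Qed.

Lemma grid_bump_le1 a x : grid_bump a x <= 1.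
Proof.
suff /andP[] : 0 <= grid_bump a x <= 1 by [].
rewrite /grid_bump; elim/big_ind: _ => [|y z /andP[y0 y1] /andP[z0 z1]|j _].
- by rewrite ler01 lexx.
- by rewrite mulr_ge0// mulr_ile1.
- by rewrite le_max lexx/= ge_max ler01/= gerBl.
Qed.

Lemma grid_bump_neq0 a x j : grid_bump a x != 0 ->
  `|M%:R * (x 0 j + 1) - (a j)%:R| < 1.
Proof.
move=> /prodf_neq0/(_ j isT); rewrite -subr_gt0.
by have [_|] := leP (1 - `|M%:R * (x 0 j + 1) - (a j)%:R|) 0; rewrite ?eqxx.
Qed.

(* Active grid points differ by at most one in each coordinate, so they are
   told apart by the parities of their coordinates. *)
Lemma grid_bump_card (x : 'rV[R]_m) : (#|[set a | grid_bump a x != 0%R]%SET| <= 2 ^ m)%N.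
Proof.
pose par (a : {ffun 'I_m -> 'I_(2 * M).+1}) := [ffun j : 'I_m => odd (a j)].
have -> : (2 ^ m)%N = #|{ffun 'I_m -> bool}| by rewrite card_ffun card_bool card_ord.
rewrite -(card_in_imset (f := par)); first exact: max_card.
move=> a b; rewrite !inE => ax bx /ffunP ab; apply/ffunP => j; apply: val_inj => /=.
have := ab j; rewrite !ffunE => oab.
have := grid_bump_neq0 j ax; have := grid_bump_neq0 j bx.
rewrite !ltr_norml => /andP[b1 b2] /andP[a1 a2].
have : (a j)%:R < (b j + 2)%:R :> R by rewrite natrD; lra.
have : (b j)%:R < (a j + 2)%:R :> R by rewrite natrD; lra.
rewrite !ltr_nat; have := congr1 nat_of_bool oab; rewrite -!modn2.
by move: (nat_of_ord (a j)) (nat_of_ord (b j)) => p q; lia.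
Qed.

Hypothesis M_gt0 : (0 < M)%N.

Lemma grid_bump_close a x y j : grid_bump a x != 0 -> grid_bump a y != 0 ->
  `|x 0 j - y 0 j| < 2 / M%:R.
Proof.
move=> /grid_bump_neq0-/(_ j) ax /grid_bump_neq0-/(_ j) ay.
have M0 : 0 < M%:R :> R by rewrite ltr0n.
rewrite ltr_pdivlMr// -[X in _ * X]gtr0_norm// -normrM.
have -> : (x 0 j - y 0 j) * M%:R = (M%:R * (x 0 j + 1) - (a j)%:R) -
  (M%:R * (y 0 j + 1) - (a j)%:R) by ring.
by apply: le_lt_trans (ler_normB _ _) _; lra.
Qed.

Lemma grid_bump_exists (x : 'rV[R]_m) : (forall j, `|x 0 j| <= 1) ->
  exists a, grid_bump a x != 0.
Proof.
(* Each coordinate is rounded down to the grid. Being at most 1, it has index at most [2 * M], so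
   [inord] keeps the index. *)
move=> x1; exists [ffun j => inord (Num.truncn (M%:R * (x 0 j + 1)))].
apply/prodf_neq0 => j _; rewrite ffunE; set z := M%:R * _.
have M0 : 0 < M%:R :> R by rewrite ltr0n.
have /andP[xl xu] : -1 <= x 0 j <= 1 by rewrite -ler_norml.
have z0 : 0 <= z by rewrite mulr_ge0//; lra.
have /andP[tl tu] := truncn_itv z0.
rewrite inordK.
  rewrite gt_eqF// lt_max subr_gt0 ger0_norm ?subr_ge0// ltrBlDl.
  by move: tu; rewrite -natr1 => ->; rewrite orbT.
have : (Num.truncn z)%:R <= (2 * M)%:R :> R.
  by apply: le_trans tl _; rewrite natrM /z; nra.
by rewrite ler_nat ltnS.
Qed.
End GridBumps.

(** * Continuity of real-valued and row-valued functions *)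

Section Continuity.
Variables (R : realType) (T : topologicalType).
Implicit Types f g : T -> R.

Lemma continuous_addr f g : continuous f -> continuous g ->
  continuous (fun x => f x + g x).
Proof. by move=> cf cg x; apply: (@continuousD _ R^o); [exact: cf|exact: cg]. Qed.

Lemma continuous_subr f g : continuous f -> continuous g ->
  continuous (fun x => f x - g x).
Proof. by move=> cf cg x; apply: (@continuousB _ R^o); [exact: cf|exact: cg]. Qed.

Lemma continuous_mulr f g : continuous f -> continuous g ->
  continuous (fun x => f x * g x).
Proof. by move=> cf cg x; apply: continuousM; [exact: cf|exact: cg]. Qed.

Lemma continuous_normr f : continuous f -> continuous (fun x => `|f x|).
Proof. by move=> cf x; apply: (@cvg_norm _ R^o); exact: cf. Qed.

Lemma continuous_maxr f g : continuous f -> continuous g ->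
  continuous (fun x => Num.max (f x) (g x)).
Proof. by move=> cf cg x; apply: continuous_max; [exact: cf|exact: cg]. Qed.

Lemma continuous_minr f g : continuous f -> continuous g ->
  continuous (fun x => Num.min (f x) (g x)).
Proof. by move=> cf cg x; apply: continuous_min; [exact: cf|exact: cg]. Qed.

Lemma continuous_sumr (I : Type) (r : seq I) (P : pred I) (F : I -> T -> R) :
  (forall i, P i -> continuous (F i)) ->
  continuous (fun x => \sum_(i <- r | P i) F i x).
Proof. by apply: continuous_big; exact: (@pseudometric_normed_Zmodule.add_continuous _ R^o). Qed.

Lemma continuous_prodr (I : Type) (r : seq I) (P : pred I) (F : I -> T -> R) :
  (forall i, P i -> continuous (F i)) ->
  continuous (fun x => \prod_(i <- r | P i) F i x).
Proof. by apply: continuous_big; exact: mul_continuous. Qed.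

Lemma continuous_row n (F : T -> 'rV[R]_n) (x : T) :
  (forall i, {for x, continuous (fun y => F y 0 i)}) -> {for x, continuous F}.
Proof.
move=> cF; apply/cvg_ballP => e e0.
have : \forall y \near x, forall i, ball (F x 0 i) e (F y 0 i).
  apply: filter_forall => i; have /cvg_ballP := cF i; exact.
by apply: filterS => y Fy; split => // i j; rewrite ord1.
Qed.
End Continuity.

Lemma grid_bump_continuous (R : realType) (m M : nat) a :
  continuous (@grid_bump R m M a).
Proof.
apply: continuous_prodr => j _; apply: continuous_maxr; first exact: cst_continuous.
apply: continuous_subr; first exact: cst_continuous.
apply: continuous_normr; apply: continuous_subr; last exact: cst_continuous.
apply: continuous_mulr; first exact: cst_continuous.
apply: continuous_addr; last exact: cst_continuous.
exact: coord_continuous.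
Qed.

Lemma flag_weight_continuous (R : realType) (A : finType) (T : topologicalType)
    (f : A -> T -> R) (c : T -> R) s :
  (forall a, continuous (f a)) -> continuous c ->
  continuous (fun x => flag_weight (f^~ x) (c x) s).
Proof.
move=> cf cc; apply: continuous_prodr => a _; apply: continuous_mulr => //.
apply: continuous_prodr => b _; apply: continuous_maxr; first exact: cst_continuous.
by apply: continuous_subr => //; exact: continuous_minr.
Qed.

(** * The Euclidean sphere: radial retraction, compactness, uniform continuity *)

Section Sphere.
Variables (R : realType) (m : nat).

Definition euclidean_norm (y : 'rV[R]_m) : R := Num.sqrt (\sum_(j < m) y 0 j ^+ 2).

(* The radial projection to the sphere, made continuous across the origin: it
   is only a projection outside the ball of radius 1/2. *)
Definition radial_retract (y : 'rV[R]_m) : 'rV[R]_m :=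
  (Num.max (euclidean_norm y) 2^-1)^-1 *: y.

Lemma sum_sqr_ge0 (y : 'rV[R]_m) : 0 <= \sum_(j < m) y 0 j ^+ 2.
Proof. by apply: sumr_ge0 => j _; exact: sqr_ge0. Qed.

Lemma sum_sqr_continuous : continuous (fun y : 'rV[R]_m => \sum_(j < m) y 0 j ^+ 2).
Proof.
apply: continuous_sumr => j _; apply: continuous_mulr; exact: coord_continuous.
Qed.

Lemma euclidean_norm_continuous : continuous euclidean_norm.
Proof.
move=> y; apply: (@continuous_comp _ _ _ (fun y : 'rV[R]_m => \sum_(j < m) y 0 j ^+ 2)).
  exact: sum_sqr_continuous.
exact: sqrt_continuous.
Qed.

Let max_gt0 y : 0 < Num.max (euclidean_norm y) 2^-1.
Proof. by rewrite lt_max invr_gt0 ltr0n orbT. Qed.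

Lemma radial_retract_continuous : continuous radial_retract.
Proof.
move=> y; apply: (@continuousZ _ _ _ (fun y => (Num.max (euclidean_norm y) 2^-1)^-1) id).
  apply: continuousV; first by rewrite gt_eqF.
  apply: continuous_maxr; first exact: euclidean_norm_continuous.
  exact: cst_continuous.
exact: cvg_id.
Qed.

Lemma radial_retract_sum_sqr y : \sum_(j < m) radial_retract y 0 j ^+ 2 =
  (euclidean_norm y / Num.max (euclidean_norm y) 2^-1) ^+ 2.
Proof.
rewrite exprMn /euclidean_norm sqr_sqrtr ?sum_sqr_ge0// mulr_suml.
by apply: eq_bigr => j _; rewrite mxE exprMn mulrC.
Qed.

Lemma radial_retract_sphere y : 2^-1 <= euclidean_norm y ->
  euclidean_sphere R m (radial_retract y).
Proof.
move=> y2; rewrite /euclidean_sphere /= radial_retract_sum_sqr max_l//.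
by rewrite divff ?expr1n// gt_eqF// (lt_le_trans _ y2)// invr_gt0 ltr0n.
Qed.

Lemma radial_retract_id y : euclidean_sphere R m y -> radial_retract y = y.
Proof.
rewrite /euclidean_sphere /radial_retract /euclidean_norm /= => ->.
rewrite sqrtr1 max_l ?invr1 ?scale1r//.
by rewrite invf_le1 ?ltr0n// ler1n.
Qed.

Lemma coord_le_sum_sqr (y : 'rV[R]_m) j :
  \sum_(j < m) y 0 j ^+ 2 <= 1 -> `|y 0 j| <= 1.
Proof.
move=> y1; rewrite -[leRHS]ger0_norm// -ler_sqr ?nnegrE// !real_normK ?num_real//.
rewrite expr1n; apply: le_trans y1; rewrite (bigD1 j)//= lerDl.
by apply: sumr_ge0 => i _; exact: sqr_ge0.
Qed.

(** Covers also the points near the origin, whose images are not on the sphere, so that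
    [grid_bump_exists] finds an active bump at every image. *)
Lemma radial_retract_le1 y j : `|radial_retract y 0 j| <= 1.
Proof.
apply: coord_le_sum_sqr; rewrite radial_retract_sum_sqr.
apply: exprn_ile1; first by rewrite divr_ge0 ?sqrtr_ge0// ltW.
by rewrite ler_pdivrMr// mul1r le_max lexx.
Qed.

Lemma euclidean_sphere_closed : closed (euclidean_sphere R m).
Proof.
have -> : euclidean_sphere R m =
    (fun y : 'rV[R]_m => \sum_(j < m) y 0 j ^+ 2) @^-1` [set x | x = 1] by [].
apply: preimage_closed; last exact: closed_eq.
by move=> y _; exact: sum_sqr_continuous.
Qed.

Lemma euclidean_sphere_compact : compact (euclidean_sphere R m).
Proof.
apply: bounded_closed_compact; last exact: euclidean_sphere_closed.
exists 1; split => // M M1 y yS; rewrite /Num.norm/= mx_normrE.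
apply/bigmax_leP; split => /=; first exact: le_trans ler01 (ltW M1).
move=> [i j] _; rewrite ord1; apply: le_trans (ltW M1).
by apply: coord_le_sum_sqr; rewrite yS.
Qed.

(** Heine-Cantor by compactness, in coordinatewise distance; only [x] has to lie on the sphere. Both
    points are compared with the centre of a ball on which [F] stays within [e / 2] of its central
    value. *)
Lemma sphere_uniform_continuous (F : 'rV[R]_m -> R) (e : R) : continuous F -> 0 < e ->
  exists2 dl : R, 0 < dl & forall x y : 'rV[R]_m, euclidean_sphere R m x ->
    (forall j, `|x 0 j - y 0 j| < dl) -> `|F x - F y| < e.
Proof.
move=> cF e0.
have /compact_near_coveringP := euclidean_sphere_compact.
pose P (dl : R) (x : 'rV[R]_m) :=
  forall y : 'rV[R]_m, (forall j, `|x 0 j - y 0 j| < dl) -> `|F x - F y| < e.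
move=> /(_ R (0^'+) P _)[].
  move=> x _; have /cvgrPdist_lt/(_ (e / 2))/(_ _)/nbhs_ballP[|r /= r0 xr] := cF x.
    by rewrite divr_gt0.
  have r2 : 0 < r / 2 by rewrite divr_gt0.
  exists (ball x (r / 2), [set dl | dl < r / 2]) => /=.
    by split; [exact: nbhsx_ballx|exact: nbhs_right_lt].
  move=> [z dl] /= [xz dlr] y zy.
  have -> : F z - F y = (F x - F y) - (F x - F z) by ring.
  apply: le_lt_trans (ler_normB _ _) _; rewrite (splitr e); apply: ltrD.
    apply: xr; split => // i j; rewrite ord1 /ball/= (splitr r).
    have [_ /(_ 0 j)] := xz; rewrite /ball/= => xzj.
    apply: le_lt_trans (ler_distD (z 0 j) _ _) _; apply: ltrD => //.
    exact: lt_trans (zy j) dlr.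
  by apply: xr; apply: le_ball xz; rewrite ler_pdivrMr// ler_peMr ?ler1n// ltW.
(* Every positive number below [dl] works; halving gives one of them. *)
move=> dl /= dl0 dlP; exists (dl / 2); first by rewrite divr_gt0.
move=> x y xS xy; apply: (dlP (dl / 2) _ _ x xS y xy) => /=.
  by rewrite sub0r normrN gtr0_norm ?divr_gt0// ltr_pdivrMr// ltr_pMr// ltr1n.
by rewrite divr_gt0.
Qed.
End Sphere.

(** * The filling of a sphere map over the ball *)

Section Filling.
Variables (R : realType) (m n : nat) (K : {set {set 'I_n}}) (T : {set 'I_n}).
Hypothesis K_down : forall S S' : {set 'I_n}, S' \subset S -> S \in K -> S' \in K.
Hypothesis TK : T \in K.
Variable F : 'I_n -> 'rV[R]_m -> R.
Hypothesis F_continuous : forall i, continuous (F i).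
Hypothesis F_realization : forall x, euclidean_sphere R m x ->
  realization R K (\row_i F i x).

Lemma sphere_map_ge0 x i : euclidean_sphere R m x -> 0 <= F i x.
Proof. by move=> /F_realization[/(_ i)]; rewrite mxE. Qed.

Lemma sphere_map_sum x : euclidean_sphere R m x -> \sum_i F i x = 1.
Proof. by move=> /F_realization[_ + _]; under eq_bigr do rewrite mxE. Qed.

Lemma sphere_map_support x : euclidean_sphere R m x ->
  [set i | F i x != 0]%SET \in K.
Proof.
move=> /F_realization[_ _]; congr (_ \in K).
by apply/setP => i; rewrite !inE mxE.
Qed.

(* A simplicial approximation of [F] on a fine grid: Lebesgue's number for the
   cover of the sphere by the preimages of the open stars. *)
Lemma grid_vertices (i0 : 'I_n) : exists M, (0 < M)%N /\
  exists v : {ffun 'I_m -> 'I_(2 * M).+1} -> 'I_n,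
    forall a x, euclidean_sphere R m x -> grid_bump a x != 0 -> F (v a) x != 0.
Proof.
(* At each point of the sphere some coordinate is at least [e], since [n] numbers below
   [1 / (n + 1)] cannot sum to 1. *)
pose e : R := n.+1%:R^-1.
have e0 : 0 < e by rewrite invr_gt0 ltr0n.
have /choice[dl dlP] : forall i, exists dl : R, 0 < dl /\
    forall x y : 'rV[R]_m, euclidean_sphere R m x ->
    (forall j, `|x 0 j - y 0 j| < dl) -> `|F i x - F i y| < e.
  move=> i; have [dl dl0 dlP] := sphere_uniform_continuous (F_continuous (i := i)) e0.
  by exists dl.
(* Points sharing an active bump differ by less than [2 / M] in each coordinate, which this choice
   puts below every [dl i]. *)
pose M := (\max_i Num.truncn (2 / dl i)).+1.
have M0 : 0 < M%:R :> R by rewrite ltr0n.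
have Mdl i : 2 / M%:R < dl i.
  have d0 := (dlP i).1.
  rewrite ltr_pdivrMr// mulrC -ltr_pdivrMr//.
  apply: lt_le_trans (truncnS_gt _) _.
  by rewrite ler_nat ltnS; exact: (leq_bigmax i).
exists M; split => //.
suff /choice : forall a : {ffun 'I_m -> 'I_(2 * M).+1}, exists i,
    forall x, euclidean_sphere R m x -> grid_bump a x != 0 -> F i x != 0.
  by move=> [v vP]; exists v.
move=> a; have [[x [xS ax]]|noS] := pselect (exists x, euclidean_sphere R m x /\
    grid_bump a x != 0); last first.
  (* A bump vanishing on the whole sphere imposes no condition and gets the default vertex. *)
  by exists i0 => x xS ax; exfalso; apply: noS; exists x.
have [i ei] : exists i, e <= F i x.
  apply/existsP; apply: contraT; rewrite negb_exists => /forallP xe.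
  have : \sum_i F i x <= \sum_(i < n) e.
    by apply: ler_sum => i _; rewrite ltW// ltNge xe.
  rewrite sphere_map_sum// sumr_const card_ord -mulr_natr /e mulrC.
  by rewrite ler_pdivlMr ?ltr0n// mul1r ler_nat ltnn.
exists i => y yS ay; rewrite gt_eqF//.
have := (dlP i).2 x y xS (fun j => lt_trans (grid_bump_close _ j ax ay) (Mdl i)).
by rewrite ltr_norml => /(_ isT) /andP[_]; lra.
Qed.

Variables (M : nat) (v : {ffun 'I_m -> 'I_(2 * M).+1} -> 'I_n).
Hypothesis M_gt0 : (0 < M)%N.
Hypothesis v_support : forall a x, euclidean_sphere R m x ->
  grid_bump a x != 0 -> F (v a) x != 0.
Variable t : {set {ffun 'I_m -> 'I_(2 * M).+1}} -> 'I_n.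
Hypothesis t_apex : forall s : {set {ffun 'I_m -> 'I_(2 * M).+1}},
  (#|s| <= 2 ^ m)%N -> cone_apex K T (apexes_below v t s) (t s).

Let u := @radial_retract R m.
Let bump y (a : {ffun 'I_m -> 'I_(2 * M).+1}) : R := grid_bump a (u y).

(* As [depth y] grows from 0 to 1/8 the filling moves linearly from [F] to its
   grid approximation; then [level y] grows from 0 past 1 and pushes the part
   of the bumps below the level onto the apexes of its superlevel sets. *)
Definition depth (y : 'rV[R]_m) : R := 1 - euclidean_norm y.
Definition level (y : 'rV[R]_m) : R := Num.max 0 (8 * depth y - 1).

(** Barycentric coordinates before normalisation. The factors [depth y] and [level y] make the last
    two terms vanish on the sphere. The empty set is excluded because its flag weight, an empty
    product, is always 1. *)
Definition filling_weight (i : 'I_n) (y : 'rV[R]_m) : R :=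
  Num.max 0 (1 - 8 * depth y) * F i (u y)
  + (\sum_(a | v a == i) depth y * Num.max 0 (bump y a - level y)
  + \sum_(s | (t s == i) && (s != finset.set0))
      level y * flag_weight (bump y) (level y) s).

Lemma depth_continuous : continuous depth.
Proof.
apply: continuous_subr; first exact: cst_continuous.
exact: euclidean_norm_continuous.
Qed.

Lemma level_continuous : continuous level.
Proof.
apply: continuous_maxr; first exact: cst_continuous.
apply: continuous_subr; last exact: cst_continuous.
by apply: continuous_mulr; [exact: cst_continuous|exact: depth_continuous].
Qed.

Lemma bump_continuous a : continuous (bump^~ a).
Proof.
move=> y; apply: continuous_comp; first exact: radial_retract_continuous.
exact: grid_bump_continuous.
Qed.

Lemma filling_weight_continuous i : continuous (filling_weight i).
Proof.
have cd := depth_continuous; have cl := level_continuous.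
have cb := bump_continuous.
apply: continuous_addr.
  apply: continuous_mulr.
    apply: continuous_maxr; first exact: cst_continuous.
    apply: continuous_subr; first exact: cst_continuous.
    by apply: continuous_mulr => //; exact: cst_continuous.
  move=> y; apply: continuous_comp; first exact: radial_retract_continuous.
  exact: F_continuous.
apply: continuous_addr.
  apply: continuous_sumr => a _; apply: continuous_mulr => //.
  apply: continuous_maxr; first exact: cst_continuous.
  exact: continuous_subr.
apply: continuous_sumr => s _; apply: continuous_mulr => //.
exact: flag_weight_continuous.
Qed.

Let depth_sphere y : depth y <= 2^-1 -> euclidean_sphere R m (u y).
Proof. by rewrite /depth => dy; apply: radial_retract_sphere; lra. Qed.

Let bump_ge0 y a : 0 <= bump y a. Proof. exact: grid_bump_ge0. Qed.

Let level_ge0 y : 0 <= level y. Proof. by rewrite le_max lexx. Qed.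

Let depth_ge0 y : euclidean_ball R m y -> 0 <= depth y.
Proof.
rewrite /euclidean_ball /depth /euclidean_norm /= subr_ge0 => y1.
by rewrite -sqrtr1 ler_sqrt ?ler01.
Qed.

(** The sign of [F] is known only on the sphere; where the first factor is nonzero, the depth is
    below 1/8 and [u y] is on the sphere. *)
Let start_ge0 i y : 0 <= Num.max 0 (1 - 8 * depth y) * F i (u y).
Proof.
have [d8|d8] := leP (1 - 8 * depth y) 0; first by rewrite mul0r.
by apply: mulr_ge0; [exact: ltW|apply: sphere_map_ge0; apply: depth_sphere; lra].
Qed.

Let grid_ge0 i y : euclidean_ball R m y ->
  0 <= \sum_(a | v a == i) depth y * Num.max 0 (bump y a - level y).
Proof.
move=> yB; apply: sumr_ge0 => a _; apply: mulr_ge0; first exact: depth_ge0.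
by rewrite le_max lexx.
Qed.

Let apex_ge0 i y : 0 <= \sum_(s | (t s == i) && (s != finset.set0))
  level y * flag_weight (bump y) (level y) s.
Proof. by apply: sumr_ge0 => s _; rewrite mulr_ge0// flag_weight_ge0. Qed.

Lemma filling_weight_ge0 i y : euclidean_ball R m y -> 0 <= filling_weight i y.
Proof. by move=> yB; rewrite !addr_ge0// grid_ge0. Qed.

(** Allows division by the total weight. A positive level gives weight to the apex of the set of all
    active bumps; depth below 1/8 leaves weight on [F]. *)
Lemma filling_weight_exists y : euclidean_ball R m y ->
  exists i, 0 < filling_weight i y.
Proof.
move=> yB; have [a aN0] := grid_bump_exists M_gt0 (@radial_retract_le1 R m y).
have {}aN0 : bump y a != 0 := aN0.
have ba : 0 < bump y a by rewrite lt_def aN0 bump_ge0.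
have [l0|l0] := eqVneq (level y) 0; last first.
  have lp : 0 < level y by rewrite lt_def l0 level_ge0.
  pose s := [set a | bump y a != 0]%SET.
  exists (t s); rewrite /filling_weight addrA ltr_wpDl//.
    by rewrite addr_ge0// grid_ge0.
  rewrite (bigD1 s)/=; last first.
    rewrite eqxx; apply/set0Pn; exists a; by rewrite inE.
  rewrite ltr_pwDl//; first by rewrite mulr_gt0// flag_weight_support_gt0.
  by apply: sumr_ge0 => s' _; rewrite mulr_ge0// flag_weight_ge0.
have d8 : 8 * depth y <= 1.
  by have : 8 * depth y - 1 <= level y; [rewrite le_max lexx orbT|rewrite l0; lra].
have [d8'|d8'] := ltP (8 * depth y) 1.
  have uS : euclidean_sphere R m (u y) by apply: depth_sphere; lra.
  have [i Fi] : exists i, F i (u y) != 0.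
    apply/existsP; apply: contraT; rewrite negb_exists => /forallP F0.
    have : \sum_i F i (u y) = 0.
      by apply: big1 => i _; apply/eqP; have := F0 i; rewrite negbK.
    by rewrite sphere_map_sum// => /eqP; rewrite oner_eq0.
  exists i; rewrite /filling_weight ltr_pwDl ?addr_ge0 ?grid_ge0//.
  rewrite mulr_gt0// ?lt_max ?subr_gt0 ?d8' ?orbT//.
  by rewrite lt_def Fi sphere_map_ge0.
(* The depth is exactly 1/8: the first term has just vanished, the level is still 0, and only the
   grid term is positive. *)
exists (v a); rewrite /filling_weight addrCA ltr_pwDl ?addr_ge0//.
rewrite (bigD1 a)//= ltr_pwDl//.
  rewrite l0 subr0 mulr_gt0//; first lra.
  by rewrite lt_max ba orbT.
apply: sumr_ge0 => b _; apply: mulr_ge0; first exact: depth_ge0.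
by rewrite le_max lexx.
Qed.

(** Three regimes. At depth below 1/8 the support stays in the simplex carrying [F] at [u y]. At
    level at least 1 no bump exceeds the level, so only apexes remain, all in [T]. In between, the
    support is covered by [cone_apexes_chain]. *)
Lemma filling_weight_support y : euclidean_ball R m y ->
  [set i | filling_weight i y != 0]%SET \in K.
Proof.
move=> yB.
have wt i : filling_weight i y != 0 ->
  [\/ Num.max 0 (1 - 8 * depth y) != 0 /\ F i (u y) != 0,
      exists2 a, v a = i & depth y != 0 /\ level y < bump y a |
      exists2 s, t s = i & [/\ s != finset.set0, level y != 0 &
        flag_weight (bump y) (level y) s != 0]].
  rewrite /filling_weight; have [->|?] := eqVneq (Num.max 0 (1 - 8 * depth y) * F i (u y)) 0.
    rewrite add0r; set G := \sum_(a | v a == i) _; have [->|] := eqVneq G 0.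
      rewrite add0r => sN0; apply: Or33.
      have [s /andP[/andP[/eqP <- s0]]] : exists s, (t s == i) && (s != finset.set0) &&
          (level y * flag_weight (bump y) (level y) s != 0).
        apply/existsP; apply: contraNT sN0; rewrite negb_exists => /forallP s0.
        apply/eqP; apply: big1 => s sP; have := s0 s.
        by rewrite sP negbK => /eqP.
      by rewrite mulf_eq0 negb_or => /andP[? ?]; exists s.
    move=> sN0 _; apply: Or32.
    have [a /andP[/eqP <-]] : exists a, (v a == i) &&
        (depth y * Num.max 0 (bump y a - level y) != 0).
      apply/existsP; apply: contraNT sN0; rewrite negb_exists => /forallP a0.
      apply/eqP; apply: big1 => a aP; have := a0 a.
      by rewrite aP negbK => /eqP.
    rewrite mulf_eq0 negb_or => /andP[d0].
    have [_|] := leP (bump y a - level y) 0; first by rewrite eqxx.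
    by rewrite subr_gt0 => la _; exists a.
  move=> _; apply: Or31; apply/andP.
  by rewrite -negb_or -mulf_eq0.
have bcard s : flag_weight (bump y) (level y) s != 0 -> (#|s| <= 2 ^ m)%N.
  move=> sN0; apply: leq_trans (@grid_bump_card R m M (u y)).
  apply: subset_leq_card; apply/fintype.subsetP => a as_; rewrite inE.
  by have [] := flag_weight_neq0 sN0 as_.
have [d8|d8] := ltP (8 * depth y) 1.
  have uS : euclidean_sphere R m (u y) by apply: depth_sphere; lra.
  have l0 : level y = 0 by rewrite /level max_l//; lra.
  apply: K_down (sphere_map_support uS); apply/fintype.subsetP => i; rewrite !inE.
  move=> /wt[[]//|[a <- [_ la]]|[s _ []]]; last by rewrite l0 eqxx.
  by apply: v_support => //; rewrite gt_eqF// -l0.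
have start0 : Num.max 0 (1 - 8 * depth y) = 0 by rewrite max_l//; lra.
have [l1|l1] := leP 1 (level y).
  apply: K_down TK; apply/fintype.subsetP => i; rewrite inE.
  move=> /wt[[]|[a _ [_ la]]|[s <- [_ _ /bcard sD]]]; first by rewrite start0 eqxx.
    by have := lt_le_trans la (grid_bump_le1 _ _); rewrite ltNge l1.
  by have [] := t_apex sD.
(* A level below 1 means depth below 1/4, so the retraction still lands on the sphere. *)
have uS : euclidean_sphere R m (u y).
  by apply: depth_sphere; move: l1; rewrite /level gt_max => /andP[_]; lra.
pose B := [set a | level y < bump y a]%SET.
pose C := [set s | (s != finset.set0) && (flag_weight (bump y) (level y) s != 0)]%SET.
apply: (@K_down (v @: B :|: t @: C)%SET).
  apply/fintype.subsetP => i; rewrite !inE.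
  move=> /wt[[]|[a <- [_ la]]|[s <- [s0 _ sw]]]; first by rewrite start0 eqxx.
    by rewrite imset_f// inE.
  by rewrite [X in _ || X]imset_f ?orbT// inE s0.
apply: (cone_apexes_chain t_apex).
- move=> s; rewrite inE => /andP[/set0Pn[a as_] sw]; rewrite bcard//=.
  apply/fintype.subsetP => b; rewrite inE => lb; apply: contraT => bs.
  have [_ /(_ b bs)[_]] := flag_weight_neq0 sw as_.
  by rewrite ltNge ltW.
- move=> s s'; rewrite !inE => /andP[_ sw] /andP[_ s'w]; apply: contraT.
  rewrite negb_or => /andP[/subsetPn[a as_ as'] /subsetPn[b bs' bs]].
  have [_ /(_ b bs)[ba _]] := flag_weight_neq0 sw as_.
  have [_ /(_ a as')[ab _]] := flag_weight_neq0 s'w bs'.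
  by have := lt_trans ab ba; rewrite ltxx.
(* The vertices of the bumps above the level all lie in the simplex carrying [F] at [u y]. *)
- apply: K_down (sphere_map_support uS); apply/fintype.subsetP => i.
  move=> /imsetP[a]; rewrite !inE => la ->; apply: v_support => //.
  by rewrite gt_eqF// (le_lt_trans (level_ge0 y)).
Qed.

Lemma filling_weight_sphere i y : euclidean_sphere R m y ->
  filling_weight i y = F i y.
Proof.
move=> yS; have d0 : depth y = 0.
  by rewrite /depth /euclidean_norm yS sqrtr1 subrr.
have l0 : level y = 0 by rewrite /level d0 mulr0 sub0r max_l// lerN10.
rewrite /filling_weight l0 d0 mulr0 subr0 max_r ?ler01// mul1r.
rewrite /u radial_retract_id// !big1 ?addr0// => *; by rewrite mul0r.
Qed.

Definition filling (y : 'rV[R]_m) : 'rV[R]_n :=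
  \row_i (filling_weight i y / \sum_j filling_weight j y).

Lemma filling_weight_sum_gt0 y : euclidean_ball R m y ->
  0 < \sum_j filling_weight j y.
Proof.
move=> yB; have [i wi] := filling_weight_exists yB.
rewrite (bigD1 i)//= ltr_pwDl//.
by apply: sumr_ge0 => j _; exact: filling_weight_ge0.
Qed.

Lemma filling_continuous y : euclidean_ball R m y -> {for y, continuous filling}.
Proof.
move=> /filling_weight_sum_gt0 yB; apply: continuous_row => i.
have -> : (fun y => filling y 0 i) =
    (fun y => filling_weight i y * (\sum_j filling_weight j y)^-1).
  by apply/funext => z; rewrite mxE.
apply: continuousM; first exact: filling_weight_continuous.
apply: continuousV; first by rewrite gt_eqF.
by apply: continuous_sumr => j _; exact: filling_weight_continuous.
Qed.

Lemma filling_realization y : euclidean_ball R m y ->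
  realization R K (filling y).
Proof.
move=> yB; have s0 := filling_weight_sum_gt0 yB; split.
- by move=> i; rewrite mxE divr_ge0// ?filling_weight_ge0// ltW.
- under eq_bigr do rewrite mxE.
  by rewrite -mulr_suml divff// gt_eqF.
- have := filling_weight_support yB; congr (_ \in K); apply/setP => i.
  by rewrite !inE mxE mulf_eq0 invr_eq0 (gt_eqF s0) orbF.
Qed.

Lemma filling_sphere y : euclidean_sphere R m y -> filling y = \row_i F i y.
Proof.
move=> yS; apply/rowP => i; rewrite !mxE filling_weight_sphere//.
under eq_bigr do rewrite filling_weight_sphere//.
by rewrite sphere_map_sum// divr1.
Qed.
End Filling.

(** * Extension of maps from the sphere to the ball, and the connectivity theorem *)

Lemma sphere_map_extension (R : realType) (m n : nat) (K : {set {set 'I_n}})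
    (f : euclidean_sphere R m -> realization R K) : continuous f ->
  exists F : 'I_n -> 'rV[R]_m -> R, (forall i, continuous (F i)) /\
    forall (x : euclidean_sphere R m) i, F i (val x) = val (f x) 0 i.
Proof.
move=> cf; suff /choice[F FP] : forall i : 'I_n, exists Fi : 'rV[R]_m -> R,
    continuous Fi /\ forall x : euclidean_sphere R m, Fi (val x) = val (f x) 0 i.
  by exists F; split=> [i|x i]; [exact: (FP i).1|exact: (FP i).2].
move=> i; pose fi (x : euclidean_sphere R m) : R^o := val (f x) 0 i.
have cfi : continuous fi.
  move=> x; apply: (@continuous_comp _ _ _ (fun x => val (f x))
      (fun p : 'rV[R]_n => p 0 i)); last exact: coord_continuous.
  apply: (@continuous_comp _ _ _ f val); first exact: cf.
  exact: initial_continuous.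
have valLfi (x : euclidean_sphere R m) : 'valL_(0 : R^o) fi (val x) = fi x.
  by have /(congr1 (fun h => h x)) := @valLK _ _ (0 : R^o) (euclidean_sphere R m) fi.
(* Tietze's theorem for one coordinate, bounded by 1 because barycentric coordinates are. Off the
   sphere the values of [g] need not be barycentric coordinates. *)
have [||g [fg cg _]] := @continuous_bounded_extension _ R pseudometric_normal
    _ (@euclidean_sphere_closed R m) ('valL_(0 : R^o) fi) 1 ltr01.
- exact/subspace_valL_continuousP'.
- move=> x /mem_set xS; have -> : x = val (exist _ x xS : euclidean_sphere R m) by [].
  rewrite valLfi /fi; have /set_mem[p0 p1 _] := valP (f (exist _ x xS)).
  rewrite ger0_norm// -p1 (bigD1 i)//= lerDl.
  by apply: sumr_ge0 => j _.
exists g; split => // x; rewrite -/(fi x) -valLfi fg//.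
by apply/mem_set/set_mem/valP.
Qed.

(** The size bound is that of [cone_apexes_exist] with [D = 2 ^ m], the largest number of bumps
    active at one point. *)
Lemma cone_complex_extension (R : realType) (m n : nat) (K : {set {set 'I_n}})
    (T : {set 'I_n}) :
  (forall S S' : {set 'I_n}, S' \subset S -> S \in K -> S' \in K) -> T \in K ->
  (forall U : {set 'I_n}, (#|U| <= 2 ^ m + 2 ^ (2 ^ m))%N ->
    exists t, cone_apex K T U t) ->
  forall f : euclidean_sphere R m -> realization R K, continuous f ->
  exists2 g : euclidean_ball R m -> realization R K, continuous g &
    forall (x : euclidean_sphere R m) (y : euclidean_ball R m),
      val x = val y -> g y = f x.
Proof.
move=> Kdown TK coneK f /sphere_map_extension[F [cF Ff]].
have Freal x : euclidean_sphere R m x -> realization R K (\row_i F i x).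
  move=> /mem_set xS; have /set_mem := valP (f (exist _ x xS)).
  congr (realization R K _); apply/rowP => i; rewrite mxE.
  by rewrite -(Ff (exist _ x xS)).
have [i0 _] : exists t, cone_apex K T finset.set0 t by apply: coneK; rewrite cards0.
have [M [M0 [v vP]]] := grid_vertices cF Freal i0.
have [t tP] := cone_apexes_exist v coneK.
pose G := filling F v t.
have GB (y : euclidean_ball R m) : G (val y) \in realization R K.
  by apply/mem_set/(filling_realization Kdown TK Freal M0 vP tP)/set_mem/valP.
exists (fun y => exist _ (G (val y)) (GB y)).
  apply: continuous_comp_initial.
  have cG : continuous (fun y : euclidean_ball R m => G (val y)).
    move=> y; apply: (@continuous_comp _ _ _ (val : euclidean_ball R m -> 'rV[R]_m)
      (G : 'rV[R]_m -> 'rV[R]_n) y); first exact: initial_continuous.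
    by apply: (filling_continuous cF Freal M0) => //; exact/set_mem/valP.
  exact: cG.
move=> x y xy; apply: val_inj => /=; rewrite -xy /G (filling_sphere Freal).
  by apply/rowP => i; rewrite mxE Ff.
exact/set_mem/valP.
Qed.

Theorem theorem3p1 (R : realType) (d : nat) (k : int) :
  (1 <= d)%N -> -1 <= k ->
  exists N : nat, (0 < N)%N /\
    forall (n : nat) (X : 'I_n -> 'rV[R]_d), (N <= phi X)%N ->
      k_connected R k (realization R (general_position_complex X)).
Proof.
move=> _ k1; have [p kp] : exists p : nat, k + 1 = p%:Z.
  by exists `|(k + 1)%R|%N; lia.
(* The bound of [general_position_cone] for the largest [U] to be coned off, in the top case
   [m = p], where [p = k + 1]. The successor gives the strict inequality. *)
exists (2 ^ (2 ^ p + 2 ^ (2 ^ p)) * d).+1; split => // n X.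
have [T gT ->] := phi_witness X; move=> NT m; rewrite kp lez_nat => mp.
apply: (@cone_complex_extension _ _ _ _ T).
- move=> S S' S'S; rewrite !inE.
  exact: general_position_sub S'S.
- by rewrite !inE.
move=> U Um; have [||t tT tU] := @general_position_cone _ _ _ X T U => //.
  apply: leq_ltn_trans NT; rewrite leq_mul2r leq_exp2l//; apply/orP; right.
  by apply: leq_trans Um _; rewrite leq_add// !leq_exp2l.
exists t; split => // S SU; rewrite !inE.
exact: tU.
Qed.
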